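(* Consider the 2-dimensional metric $$g=b\,x^2\,\mathrm dt^2+(1+b\,t^2)\,\mathrm dx^2-2b\,x\,t\,\mathrm dx\,\mathrm dt$$ in the case $b<0$ of Minkowski signature. Then, up to a choice of time orientation, all timelike geodesics emerge and end respectively at two points on the $t$-axis, namely $$P_-=\Big(0,-\frac1{\sqrt{-b}}\Big)\quad\text{and}\quad P_+=\Big(0,\frac1{\sqrt{-b}}\Big)$$ in coordinates $(x,t)$.
   Context: The Ricci curvature of $g$ is proportional to $g/x^2$, so it is singular along the $t$-axis $x=0$. The spatial coordinate $x$ is allowed to be negative, and geodesics are continued through $x=0$. A geodesic is timelike if $g(\dot\gamma,\dot\gamma)<0$, and it is parametrised by proper time $\tau$ with $g(\dot\gamma,\dot\gamma)=-1$. Explicitly, the quantity $M=x^2(x\,\dot t-t\,\dot x)$ is a nonzero constant of motion. With $D=(-bM^2)^{1/4}$ the motion is confined to $|x|\le D$. A timelike geodesic is a sequence of segments, each running between $x=-D$ and $x=D$ (alternately with $x$ increasing and decreasing), with a bounce at each boundary. The $n$-th segment ($n\in\mathbb Z$) is $$t_n(x)=xc-2n\frac{M\gamma}{D^3}x-(-1)^n\frac{M}{D^2}\Big(\sqrt{1-(x/D)^4}+\frac xD E(x/D)\Big),\qquad |x|\le D,$$ where $c$ is a constant of integration, $E(y)=\int_0^y\frac{u^2}{\sqrt{1-u^4}}\,\mathrm du$ and $\gamma=E(1)$. Each segment passes through one of $P_\pm$ when $x=0$, and successive segments pass alternately through $P_-$ and $P_+$. For $M>0$, the geodesic leaving $P_-$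 on the segment $n=0$ bounces at $x=D$ and arrives at $P_+$ on the segment $n=1$; this is the sense in which geodesics emerge from $P_-$ and end at $P_+$. The case $M<0$ is the $t$-reverse of the case $M>0$ with the sign of $c$ reversed. *)

(* Defs.v *)
From Stdlib Require Import Reals ZArith.
From Coquelicot Require Import Coquelicot.
Open Scope R_scope.

(** Stdlib reals with Coquelicot.  Points and tangent vectors of the plane are
    pairs [(x, t)]: the first component is the [x]-coordinate. *)

Inductive coord := cx | ct.

Definition comp (k : coord) (p : R * R) : R :=
  match k with cx => fst p | ct => snd p end.

Definition csum (f : coord -> R) : R := f cx + f ct.

Definition partial (k : coord) (f : R * R -> R) (p : R * R) : R :=
  match k with
  | cx => Derive (fun s => f (s, snd p)) (fst p)
  | ct => Derive (fun s => f (fst p, s)) (snd p)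
  end.

(** The cross term [-2 b x t dx dt] is split evenly between [g_xt] and [g_tx]. *)
Definition metric (b : R) (i j : coord) (p : R * R) : R :=
  match i, j with
  | cx, cx => 1 + b * (snd p) ^ 2
  | ct, ct => b * (fst p) ^ 2
  | _, _ => - (b * fst p * snd p)
  end.

Definition gprod (b : R) (p u v : R * R) : R :=
  csum (fun i => csum (fun j => metric b i j p * comp i u * comp j v)).

(** The determinant is [b x^2], so the inverse metric is only meaningful off
    the axis [x = 0]. *)
Definition metric_det (b : R) (p : R * R) : R :=
  metric b cx cx p * metric b ct ct p - metric b cx ct p * metric b ct cx p.

Definition metric_inv (b : R) (i j : coord) (p : R * R) : R :=
  match i, j with
  | cx, cx => metric b ct ct p / metric_det b p
  | ct, ct => metric b cx cx p / metric_det b p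
  | _, _ => - metric b i j p / metric_det b p
  end.

Definition christoffel (b : R) (k i j : coord) (p : R * R) : R :=
  / 2 * csum (fun l =>
    metric_inv b k l p *
      (partial i (metric b j l) p + partial j (metric b i l) p
       - partial l (metric b i j) p)).

Definition velocity (gam : R -> R * R) (tau : R) : R * R :=
  (Derive (fun s => fst (gam s)) tau, Derive (fun s => snd (gam s)) tau).

Definition geodesic_at (b : R) (gam : R -> R * R) (tau : R) : Prop :=
  forall k : coord,
    ex_derive (fun s => comp k (gam s)) tau /\
    is_derive (fun s => comp k (velocity gam s)) tau
      (- csum (fun i => csum (fun j =>
           christoffel b k i j (gam tau) *
             comp i (velocity gam tau) * comp j (velocity gam tau)))).

(** Continuation through the singular axis: near a parameter [tau0] with
    [x = 0] the curve goes across the axis, and its trajectory is the graph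
    [t = phi x] of a smooth function.  The proper-time parametrisation itself
    is not differentiable there ([x] behaves like the cube root of
    [tau - tau0]), so smoothness can only be asked of the trajectory.
    Off the axis [M = x^2 (x t' - t x')] is conserved, and a trajectory is
    determined by [M] and the integration constant [c] in
    [t = x c + F_M(x)]; smoothness of [phi] forces both to be the same on the
    two sides. *)
Definition smooth_crossing (gam : R -> R * R) (tau0 : R) : Prop :=
  exists (delta : posreal) (phi : R -> R),
    (locally 0 (fun s => forall n : nat, ex_derive_n phi n s)) /\
    (forall tau, Rabs (tau - tau0) < delta -> snd (gam tau) = phi (fst (gam tau))) /\
    ((forall s1 s2, Rabs (s1 - tau0) < delta -> Rabs (s2 - tau0) < delta ->
        s1 < s2 -> fst (gam s1) < fst (gam s2)) \/
     (forall s1 s2, Rabs (s1 - tau0) < delta -> Rabs (s2 - tau0) < delta ->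
        s1 < s2 -> fst (gam s2) < fst (gam s1))).

Definition in_interval (lo hi : Rbar) (tau : R) : Prop :=
  Rbar_lt lo tau /\ Rbar_lt tau hi.

(** Timelike geodesic on the open interval [(lo, hi)], in proper time, continued
    through [x = 0].  The values of [gam] outside the interval are irrelevant. *)
Record timelike_geodesic (b : R) (lo hi : Rbar) (gam : R -> R * R) : Prop := {
  tg_nonempty : Rbar_lt lo hi;
  tg_continuous : forall tau, in_interval lo hi tau -> continuous gam tau;
  tg_equation : forall tau, in_interval lo hi tau -> fst (gam tau) <> 0 ->
    geodesic_at b gam tau;
  tg_proper_time : forall tau, in_interval lo hi tau -> fst (gam tau) <> 0 ->
    gprod b (gam tau) (velocity gam tau) (velocity gam tau) = -1;
  tg_crossing : forall tau, in_interval lo hi tau -> fst (gam tau) = 0 ->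
    smooth_crossing gam tau
}.

(** As usual for causal curves: neither end of the curve has an endpoint in the
    [(x, t)]-plane, the axis [x = 0] included since geodesics are continued
    through it. *)
Definition inextendible (lo hi : Rbar) (gam : R -> R * R) : Prop :=
  (~ exists p : R * R,
     filterlim gam (within (fun s : R => Rbar_lt lo s) (Rbar_locally lo)) (locally p)) /\
  (~ exists p : R * R,
     filterlim gam (within (fun s : R => Rbar_lt s hi) (Rbar_locally hi)) (locally p)).

(** The metric is Lorentzian exactly off the axis. *)
Definition time_orientation (b : R) (V : R * R -> R * R) : Prop :=
  forall p : R * R, fst p <> 0 -> continuous V p /\ gprod b p (V p) (V p) < 0.

Definition future_directed (b : R) (V : R * R -> R * R) (lo hi : Rbar)
    (gam : R -> R * R) : Prop :=
  forall tau, in_interval lo hi tau -> fst (gam tau) <> 0 ->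
    gprod b (gam tau) (V (gam tau)) (velocity gam tau) < 0.

Definition past_directed (b : R) (V : R * R -> R * R) (lo hi : Rbar)
    (gam : R -> R * R) : Prop :=
  forall tau, in_interval lo hi tau -> fst (gam tau) <> 0 ->
    0 < gprod b (gam tau) (V (gam tau)) (velocity gam tau).

(** A continued geodesic oscillates in [x] and meets the axis infinitely often.
    That it emerges from [P] and ends at [Q] means that its successive passages
    through the axis are alternately at [P] and [Q], and that the arcs with
    [x > 0] lead from [P] to [Q]; the arcs with [x < 0] are the continuation
    from [Q] back to [P]. *)
Definition emerges_and_ends (lo hi : Rbar) (gam : R -> R * R) (P Q : R * R) : Prop :=
  exists theta : Z -> R,
    (forall n : Z, theta n < theta (n + 1)%Z) /\
    (forall tau : R,
       in_interval lo hi tau /\ fst (gam tau) = 0 <-> exists n : Z, tau = theta n) /\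
    (forall k : Z, gam (theta (2 * k)%Z) = P) /\
    (forall k : Z, gam (theta (2 * k + 1)%Z) = Q) /\
    (forall (k : Z) (tau : R),
       theta (2 * k)%Z < tau < theta (2 * k + 1)%Z -> 0 < fst (gam tau)) /\
    (forall (k : Z) (tau : R),
       theta (2 * k + 1)%Z < tau < theta (2 * k + 2)%Z -> fst (gam tau) < 0).

Definition P_minus (b : R) : R * R := (0, - (1 / sqrt (- b))).
Definition P_plus (b : R) : R * R := (0, 1 / sqrt (- b)).

(* Main.v *)
Require Import Defs.
From Stdlib Require Import Reals ZArith Lra Lia Classical ClassicalEpsilon.
From Coquelicot Require Import Coquelicot.
Open Scope R_scope.

(** Write [beta = - b].  Since [g = dx^2 - beta (x dt - t dx)^2], the quantities
    [m = x^2 (x t' - t x')] and [p = x^2 x'] satisfy, off the axis, [m' = 0],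
    [p' = - 2 x] and [p^2 + x^4 = beta m^2].  Moreover [(x x')' <= - 2], so an arc
    with [x <> 0] has finite duration, and with [k = 1 / (beta m)] the quantity
    [t / x + k p / x + k tau] is constant.  Hence [x] and [t] have limits at the
    ends of an arc; inextendibility then forces the arc to end on the axis, where
    [t = - k p] and [p^2 = beta m^2], that is [t = 1 / sqrt beta] or
    [t = - 1 / sqrt beta].  The sign is determined by those of [x] and [m].
    Continuity of [t] at a crossing propagates the sign of [m] from one arc to the
    next, and the crossings cannot accumulate because [t] jumps by [2 / sqrt beta]
    between consecutive ones.  For [V = x d/dt] one has [g(V, gam') = b m], so the
    sign of [m] decides the time direction. *)

(** * Geodesic equations and their reduction to a first-order system *)

Lemma partial_metric (b : R) (k i j : coord) (p : R * R) :
  partial k (metric b i j) p =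
  match k, i, j with
  | ct, cx, cx => 2 * b * snd p
  | cx, ct, ct => 2 * b * fst p
  | cx, cx, ct | cx, ct, cx => - (b * snd p)
  | ct, cx, ct | ct, ct, cx => - (b * fst p)
  | _, _, _ => 0
  end.
Proof.
  destruct p as [x t]; destruct k, i, j; unfold partial, metric; simpl;
    apply is_derive_unique; auto_derive; trivial; ring.
Qed.

(** Put [w = x v - t u]. The [t]-component is [t / x] times the [x]-component, minus [2 u w / x^2].
    Hence [x t'' - t x'' = - 2 u w / x], which is what makes [x^2 w] a constant of motion. *)
Lemma geodesic_acceleration (b x t u v : R) (hb : b <> 0) (hx : x <> 0) (k : coord) :
  - csum (fun i => csum (fun j => christoffel b k i j (x, t) *
       Defs.comp i (u, v) * Defs.comp j (u, v))) =
  match k with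
  | cx => 2 * b * (x * v - t * u) ^ 2 / x
  | ct => 2 * b * (x * v - t * u) ^ 2 / x * t / x
          - 2 * u * (x * v - t * u) / x ^ 2
  end.
Proof.
  destruct k; unfold christoffel, csum; rewrite !partial_metric;
    unfold metric_inv, metric_det, metric; simpl; field; repeat split; trivial;
    (* The denominator is the expanded determinant of the metric. *)
    match goal with |- ?d <> 0 => replace d with (b * x ^ 2) by ring end;
    apply Rmult_integral_contrapositive_currified; trivial; apply pow_nonzero; trivial.
Qed.

(** [p] stands for [x^2 x'] and [m] for [x^2 (x t' - t x')]. *)
Record axis_flow (beta : R) (I : R -> Prop) (x t p m : R -> R) : Prop := {
  af_open : forall s, I s -> exists d : posreal, forall r, Rabs (r - s) < d -> I r;
  af_convex : forall a c s, I a -> I c -> a <= s <= c -> I s;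
  af_inhabited : exists s, I s;
  af_cont_x : forall s, I s -> continuous x s;
  af_cont_t : forall s, I s -> continuous t s;
  af_x : forall s, I s -> x s <> 0 -> is_derive x s (p s / x s ^ 2);
  af_t : forall s, I s -> x s <> 0 ->
    is_derive t s ((m s + t s * p s) / x s ^ 3);
  af_p : forall s, I s -> x s <> 0 -> is_derive p s (- 2 * x s);
  af_m : forall s, I s -> x s <> 0 -> is_derive m s 0;
  af_energy : forall s, I s -> x s <> 0 -> p s ^ 2 + x s ^ 4 = beta * m s ^ 2;
  af_cross : forall s, I s -> x s = 0 -> exists d : posreal,
    (forall r1 r2, Rabs (r1 - s) < d -> Rabs (r2 - s) < d -> r1 < r2 -> x r1 < x r2) \/
    (forall r1 r2, Rabs (r1 - s) < d -> Rabs (r2 - s) < d -> r1 < r2 -> x r2 < x r1)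
}.

(** Stated at a right end only; the left end is treated by applying it to the
    time-reversed curve. *)
Definition no_right_limit (I : R -> Prop) (x t : R -> R) : Prop :=
  forall h s0 lx lt, s0 < h -> (forall s, s0 <= s < h -> I s) -> ~ I h ->
    filterlim x (at_left h) (locally lx) ->
    filterlim t (at_left h) (locally lt) -> False.

(** Since [g = dx^2 + b (x dt - t dx)^2], proper time means [u^2 + b w^2 = -1] with [w = x v - t u].
    Multiplied by [x^4] this is the energy identity; it also reduces [p' = 2 x (u^2 + b w^2)] to
    [- 2 x]. *)
Lemma axis_flow_of_geodesic (b : R) (lo hi : Rbar) (gam : R -> R * R) (hb : b < 0) :
  timelike_geodesic b lo hi gam ->
  axis_flow (- b) (in_interval lo hi) (fun s => fst (gam s)) (fun s => snd (gam s))
    (fun s => fst (gam s) ^ 2 * fst (velocity gam s))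
    (fun s => fst (gam s) ^ 2 *
       (fst (gam s) * snd (velocity gam s) - snd (gam s) * fst (velocity gam s))).
Proof.
  intros [Hne Hc Hg Hp Hx].
  assert (Hderiv : forall s, in_interval lo hi s -> fst (gam s) <> 0 ->
    let x := fst (gam s) in let t := snd (gam s) in
    let u := fst (velocity gam s) in let v := snd (velocity gam s) in
    is_derive (fun s => fst (gam s)) s u /\ is_derive (fun s => snd (gam s)) s v /\
    is_derive (fun s => fst (velocity gam s)) s (2 * b * (x * v - t * u) ^ 2 / x) /\
    is_derive (fun s => snd (velocity gam s)) s (2 * b * (x * v - t * u) ^ 2 / x * t / x
          - 2 * u * (x * v - t * u) / x ^ 2) /\
    u ^ 2 + b * (x * v - t * u) ^ 2 = -1).
  { intros s Hs Hxs x t u v.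
    destruct (Hg s Hs Hxs cx) as [E1 D1]. destruct (Hg s Hs Hxs ct) as [E2 D2].
    specialize (Hp s Hs Hxs).
    rewrite (surjective_pairing (gam s)), (surjective_pairing (velocity gam s)) in D1, D2, Hp.
    rewrite geodesic_acceleration in D1, D2 by (trivial; lra).
    fold x t u v in D1, D2, Hp.
    split; [exact (Derive_correct _ _ E1)|].
    split; [exact (Derive_correct _ _ E2)|].
    split; [exact D1|split; [exact D2|]].
    rewrite <- Hp; unfold gprod, csum, metric; simpl; ring. }
  constructor.
  - intros s [H1 H2].
    assert (HL : locally s (fun r => Rbar_lt lo r)) by exact (open_Rbar_gt' s lo H1).
    assert (HU : locally s (fun r => Rbar_lt r hi)) by exact (open_Rbar_lt' s hi H2).
    destruct (filter_and _ _ HL HU) as [d Hd].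
    exists d; intros r Hr; exact (Hd r Hr).
  - intros a c s [Ha _] [_ Hc'] [Has Hsc]; split.
    + apply Rbar_lt_le_trans with a; trivial.
    + apply Rbar_le_lt_trans with c; trivial.
  - destruct lo as [l| |], hi as [h| |]; simpl in Hne; try contradiction; unfold in_interval; simpl.
    + exists ((l + h) / 2); lra.
    + exists (l + 1); lra.
    + exists (h - 1); lra.
    + exists 0; auto.
  - intros s Hs. apply (continuous_comp gam fst); [auto|apply continuous_fst].
  - intros s Hs. apply (continuous_comp gam snd); [auto|apply continuous_snd].
  - intros s Hs Hxs. destruct (Hderiv s Hs Hxs) as [D _].
    replace (_ / _) with (fst (velocity gam s)) by (field; trivial); exact D.
  - intros s Hs Hxs. destruct (Hderiv s Hs Hxs) as [_ [D _]].
    replace (_ / _) with (snd (velocity gam s)) by (field; trivial); exact D.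
  - intros s Hs Hxs. destruct (Hderiv s Hs Hxs) as (D1 & D2 & D3 & D4 & E).
    evar_last.
    { apply (is_derive_mult (fun s => fst (gam s) ^ 2) (fun s => fst (velocity gam s))).
      - apply is_derive_pow, D1.
      - exact D3.
      - intros; apply Rmult_comm. }
    clear - E Hxs.
    set (x := fst (gam s)) in *; set (u := fst (velocity gam s)) in *.
    set (w := x * _ - _) in *.
    unfold plus, mult; simpl.
    transitivity (2 * x * (u ^ 2 + b * w ^ 2)); [field; trivial | rewrite E; ring].
  - intros s Hs Hxs. destruct (Hderiv s Hs Hxs) as (D1 & D2 & D3 & D4 & E).
    evar_last.
    { apply (is_derive_mult (fun s => fst (gam s) ^ 2)
        (fun s => fst (gam s) * snd (velocity gam s) - snd (gam s) * fst (velocity gam s))).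
      - apply is_derive_pow, D1.
      - apply @is_derive_minus; apply @is_derive_mult; try eassumption; intros; apply Rmult_comm.
      - intros; apply Rmult_comm. }
    clear - Hxs.
    set (x := fst (gam s)) in *; set (u := fst (velocity gam s)) in *.
    set (v := snd (velocity gam s)) in *.
    unfold minus, plus, opp, mult; simpl. field; trivial.
  - intros s Hs Hxs. destruct (Hderiv s Hs Hxs) as (_ & _ & _ & _ & E).
    set (x := fst (gam s)) in *; set (u := fst (velocity gam s)) in *.
    set (w := x * _ - _) in *.
    replace ((x ^ 2 * u) ^ 2) with (x ^ 4 * u ^ 2) by ring.
    replace (u ^ 2) with (- 1 - b * w ^ 2) by lra. ring.
  - intros s Hs Hxs. destruct (Hx s Hs Hxs) as (d & phi & _ & _ & H).
    exists d; exact H.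
Qed.

(** * Symmetries of the flow: time reversal and point reflection *)

(** Both [p] and [m] are linear in the velocity, so they change sign. This transfers every result
    about right ends to left ends. *)
Lemma axis_flow_reverse beta I x t p m :
  axis_flow beta I x t p m ->
  axis_flow beta (fun s => I (- s)) (fun s => x (- s)) (fun s => t (- s))
    (fun s => - p (- s)) (fun s => - m (- s)).
Proof.
  intros H.
  assert (Hopp : forall s, is_derive Ropp s (-1)).
  { intros s; auto_derive; trivial; ring. }
  assert (Hrev : forall (f : R -> R) s l, is_derive f (- s) l ->
    is_derive (fun r => f (- r)) s (- l)).
  { intros f s l Hf; evar_last; [exact (is_derive_comp f Ropp s _ _ Hf (Hopp s))|].
    unfold scal; simpl; unfold mult; simpl; ring. }
  assert (Hcont : forall (f : R -> R) s, continuous f (- s) -> continuous (fun r => f (- r)) s).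
  { intros f s Hf; apply (continuous_comp Ropp f); trivial.
    apply (ex_derive_continuous Ropp); exists (-1); apply Hopp. }
  constructor.
  - intros s Hs; destruct (af_open _ _ _ _ _ _ H _ Hs) as [d Hd]; exists d; intros r Hr.
    apply Hd; replace (- r - - s) with (- (r - s)) by ring; rewrite Rabs_Ropp; trivial.
  - intros a c s Ha Hc Hs; apply (af_convex _ _ _ _ _ _ H (- c) (- a)); trivial; lra.
  - destruct (af_inhabited _ _ _ _ _ _ H) as [s Hs]; exists (- s); rewrite Ropp_involutive; trivial.
  - intros s Hs; apply Hcont, (af_cont_x _ _ _ _ _ _ H _ Hs).
  - intros s Hs; apply Hcont, (af_cont_t _ _ _ _ _ _ H _ Hs).
  - intros s Hs Hx; evar_last; [apply Hrev, (af_x _ _ _ _ _ _ H _ Hs Hx)|field; trivial].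
  - intros s Hs Hx; evar_last; [apply Hrev, (af_t _ _ _ _ _ _ H _ Hs Hx)|field; trivial].
  - intros s Hs Hx; evar_last;
      [apply @is_derive_opp, Hrev, (af_p _ _ _ _ _ _ H _ Hs Hx)|unfold opp; simpl; ring].
  - intros s Hs Hx; evar_last;
      [apply @is_derive_opp, Hrev, (af_m _ _ _ _ _ _ H _ Hs Hx)|unfold opp; simpl; ring].
  - intros s Hs Hx; generalize (af_energy _ _ _ _ _ _ H _ Hs Hx); intros E.
    transitivity (p (- s) ^ 2 + x (- s) ^ 4); [ring|rewrite E; ring].
  - intros s Hs Hx; destruct (af_cross _ _ _ _ _ _ H _ Hs Hx) as [d [Hd|Hd]]; exists d;
      [right|left]; intros r1 r2 H1 H2 H12; apply Hd; try lra;
      match goal with |- Rabs ?e < _ => replace e with (- (- e)) by ring; rewrite Rabs_Ropp end;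
      match goal with H : Rabs ?e < _ |- Rabs ?e' < _ => replace e' with e by ring; exact H end.
Qed.

(** The reflection [(x, t) -> (-x, -t)] is an isometry under which [p] is odd and [m] is even; it
    reduces arcs with [x < 0] to arcs with [x > 0]. *)
Lemma axis_flow_flip beta I x t p m :
  axis_flow beta I x t p m ->
  axis_flow beta I (fun s => - x s) (fun s => - t s) (fun s => - p s) m.
Proof.
  intros H.
  assert (Hn : forall s, - x s <> 0 -> x s <> 0) by (intros; lra).
  constructor.
  - apply H.
  - apply (af_convex _ _ _ _ _ _ H).
  - apply H.
  - intros s Hs; apply @continuous_opp, (af_cont_x _ _ _ _ _ _ H _ Hs).
  - intros s Hs; apply @continuous_opp, (af_cont_t _ _ _ _ _ _ H _ Hs).
  - intros s Hs Hx; apply Hn in Hx; evar_last;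
      [apply @is_derive_opp, (af_x _ _ _ _ _ _ H _ Hs Hx)|unfold opp; simpl; field; trivial].
  - intros s Hs Hx; apply Hn in Hx; evar_last;
      [apply @is_derive_opp, (af_t _ _ _ _ _ _ H _ Hs Hx)|unfold opp; simpl; field; trivial].
  - intros s Hs Hx; apply Hn in Hx; evar_last;
      [apply @is_derive_opp, (af_p _ _ _ _ _ _ H _ Hs Hx)|unfold opp; simpl; ring].
  - intros s Hs Hx; apply Hn in Hx; apply (af_m _ _ _ _ _ _ H _ Hs Hx).
  - intros s Hs Hx; apply Hn in Hx; rewrite <- (af_energy _ _ _ _ _ _ H _ Hs Hx); ring.
  - intros s Hs Hx; assert (Hx' : x s = 0) by lra.
    destruct (af_cross _ _ _ _ _ _ H _ Hs Hx') as [d [Hd|Hd]]; exists d;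
      [right|left]; intros r1 r2 H1 H2 H12; apply Ropp_lt_contravar, Hd; trivial.
Qed.

Lemma no_right_limit_flip I x t :
  no_right_limit I x t -> no_right_limit I (fun s => - x s) (fun s => - t s).
Proof.
  intros H h s0 lx lt Hs HI Hh Lx Lt.
  apply (H h s0 (- lx) (- lt)); trivial.
  - apply filterlim_ext with (fun s => opp (- x s)); [intros; unfold opp; simpl; ring|].
    exact (filterlim_comp _ _ _ _ opp _ _ _ Lx (filterlim_opp lx)).
  - apply filterlim_ext with (fun s => opp (- t s)); [intros; unfold opp; simpl; ring|].
    exact (filterlim_comp _ _ _ _ opp _ _ _ Lt (filterlim_opp lt)).
Qed.

(** * Real analysis: monotonicity and one-sided limits *)

Lemma derive_nonneg_le (f df : R -> R) (a c : R) :
  a <= c -> (forall s, a <= s <= c -> is_derive f s (df s) /\ 0 <= df s) -> f a <= f c.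
Proof.
  intros Hac H.
  destruct (MVT_gen f a c df) as [s [Hs E]].
  - intros s; rewrite Rmin_left, Rmax_right by trivial; intros Hs; apply H; lra.
  - intros s; rewrite Rmin_left, Rmax_right by trivial; intros Hs.
    apply continuity_pt_filterlim, (ex_derive_continuous f); exists (df s); apply H; lra.
  - rewrite Rmin_left, Rmax_right in Hs by trivial.
    destruct (H s Hs) as [_ Hd]. nra.
Qed.

Lemma derive_zero_eq (f : R -> R) (a c : R) :
  a <= c -> (forall s, a <= s <= c -> is_derive f s 0) -> f a = f c.
Proof.
  intros Hac H; apply Rle_antisym.
  - apply (derive_nonneg_le f (fun _ => 0)); trivial; intros s Hs; split; [auto|lra].
  - apply Ropp_le_cancel, (derive_nonneg_le (fun s => - f s) (fun _ => 0)); trivial.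
    intros s Hs; split; [|lra].
    evar_last; [apply @is_derive_opp, (H s Hs)|unfold opp; simpl; ring].
Qed.

Lemma continuous_pt_eps (f : R -> R) (s eps : R) :
  continuous f s -> 0 < eps ->
  exists d : posreal, forall r, Rabs (r - s) < d -> Rabs (f r - f s) < eps.
Proof.
  intros Hf He.
  destruct (proj1 (filterlim_locally f (f s)) Hf (mkposreal eps He)) as [d Hd].
  exists d; intros r Hr; exact (Hd r Hr).
Qed.

Lemma continuous_left_le (f : R -> R) (a c M : R) :
  a < c -> continuous f c -> (forall s, a <= s < c -> f s <= M) -> f c <= M.
Proof.
  intros Hac Hf H; apply Rnot_lt_le; intros Hlt.
  destruct (continuous_pt_eps f c (f c - M) Hf ltac:(lra)) as [d Hd].
  assert (Hd0 := cond_pos d).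
  set (s := Rmax a (c - d / 2)).
  assert (Hs : a <= s < c /\ c - d / 2 <= s).
  { unfold s; repeat split; [apply Rmax_l|apply Rmax_lub_lt; lra|apply Rmax_r]. }
  specialize (H s (proj1 Hs)).
  assert (Hr : Rabs (s - c) < d) by (apply Rabs_def1; lra).
  specialize (Hd s Hr); apply Rabs_def2 in Hd; lra.
Qed.

Lemma continuous_left_eq (f : R -> R) (a c M : R) :
  a < c -> continuous f c -> (forall s, a <= s < c -> f s = M) -> f c = M.
Proof.
  intros Hac Hf H; apply Rle_antisym.
  - apply continuous_left_le with a; trivial; intros; apply Req_le; auto.
  - apply Ropp_le_cancel, (continuous_left_le (fun s => - f s) a); trivial.
    + apply @continuous_opp; trivial.
    + intros s Hs; rewrite (H s Hs); lra.
Qed.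

(** Cauchy criterion at [h] from the left. *)
Lemma lipschitz_left_limit (f : R -> R) (K a h : R) :
  a < h -> (forall r s, a <= r <= s -> s < h -> Rabs (f s - f r) <= K * (s - r)) ->
  exists l : R, filterlim f (at_left h) (locally l).
Proof.
  intros Hah Hf.
  apply (proj1 (filterlim_locally_cauchy (F := at_left h) f)).
  intros eps.
  (* No sign of [K] is assumed, so [Rabs K + 1] serves as a positive Lipschitz constant. *)
  assert (HK : 0 < Rabs K + 1) by (generalize (Rabs_pos K); lra).
  assert (Hd : 0 < Rmin (h - a) (eps / (Rabs K + 1))).
  { apply Rmin_pos; [lra|apply Rdiv_lt_0_compat; [apply cond_pos|trivial]]. }
  exists (fun s => h - Rmin (h - a) (eps / (Rabs K + 1)) < s < h); split.
  - exists (mkposreal _ Hd); intros y Hy Hyh; simpl in Hy.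
    apply Rabs_def2 in Hy; unfold minus, plus, opp in Hy; simpl in Hy; lra.
  - assert (Hm1 := Rmin_l (h - a) (eps / (Rabs K + 1))).
    assert (Hm2 := Rmin_r (h - a) (eps / (Rabs K + 1))).
    assert (Hw : forall r s, r <= s -> h - Rmin (h - a) (eps / (Rabs K + 1)) < r -> s < h ->
      Rabs (f s - f r) < eps).
    { intros r s Hrs Hr Hs.
      apply Rle_lt_trans with (K * (s - r)); [apply Hf; lra|].
      apply Rle_lt_trans with (Rabs K * (s - r)).
      { apply Rmult_le_compat_r; [lra|apply Rle_abs]. }
      apply Rle_lt_trans with ((Rabs K + 1) * (s - r)).
      { apply Rmult_le_compat_r; lra. }
      replace (pos eps) with ((Rabs K + 1) * (eps / (Rabs K + 1))) by (field; lra).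
      apply Rmult_lt_compat_l; lra. }
    intros u v [Hu1 Hu2] [Hv1 Hv2].
    change (Rabs (f v - f u) < eps).
    destruct (Rle_dec u v); [apply Hw; trivial|].
    rewrite Rabs_minus_sym; apply Hw; trivial; lra.
Qed.

(** * Arcs off the axis *)

Section Run.

Variables (beta : R) (I : R -> Prop) (x t p m : R -> R).
Hypothesis Hbeta : 0 < beta.
Hypothesis F : axis_flow beta I x t p m.

Let is_x := af_x _ _ _ _ _ _ F.
Let is_t := af_t _ _ _ _ _ _ F.
Let is_p := af_p _ _ _ _ _ _ F.
Let energy := af_energy _ _ _ _ _ _ F.

(** If [m] vanished, the energy identity would force [x^4 <= 0]. *)
Lemma angular_momentum_neq_0 s : I s -> x s <> 0 -> m s <> 0.
Proof.
  intros Hs Hx Hm; generalize (energy s Hs Hx); rewrite Hm; intros E.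
  assert (0 < x s ^ 4) by (apply Rlt_le_trans with ((x s ^ 2) ^ 2);
    [apply pow2_gt_0, pow_nonzero; trivial|apply Req_le; ring]).
  generalize (pow2_ge_0 (p s)); lra.
Qed.

Lemma run_momentum a c :
  a <= c -> (forall s, a <= s <= c -> I s /\ x s <> 0) -> m c = m a.
Proof.
  intros Hac H; symmetry; apply derive_zero_eq; trivial.
  intros s Hs; apply (af_m _ _ _ _ _ _ F); apply H; trivial.
Qed.

(* Replaces the elliptic integral of the explicit solution: the proper time
   itself enters the formula for [t]. *)
Lemma run_first_integral a c :
  a <= c -> (forall s, a <= s <= c -> I s /\ x s <> 0) ->
  let k := / (beta * m a) in
  t c = x c * (t a / x a + k * p a / x a + k * a - k * c) - k * p c.
Proof.
  intros Hac H k.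
  assert (Hm : m a <> 0) by (apply angular_momentum_neq_0; apply H; lra).
  assert (E : t a / x a + k * p a / x a + k * a = t c / x c + k * p c / x c + k * c).
  { apply (derive_zero_eq (fun s => t s / x s + k * p s / x s + k * s)); trivial.
    intros s Hs; destruct (H s Hs) as [Is Hx].
    assert (Em : m s = m a) by (apply run_momentum; [lra|intros; apply H; lra]).
    assert (E := energy s Is Hx).
    assert (Dx := is_x s Is Hx); assert (Dt := is_t s Is Hx); assert (Dp := is_p s Is Hx).
    evar_last.
    { auto_derive.
      - repeat split; trivial; eexists; eassumption.
      - reflexivity. }
    rewrite (is_derive_unique _ _ _ Dx : Derive (fun y => x y) s = _),
      (is_derive_unique _ _ _ Dt : Derive (fun y => t y) s = _), (is_derive_unique _ _ _ Dp : Derive (fun y => p y) s = _).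
    rewrite Em in *.
    (* By the energy identity the numerator is [m a - k beta (m a)^2], which vanishes by the choice
       of [k]. *)
    transitivity ((m a - k * (p s ^ 2 + x s ^ 4)) / x s ^ 4); [field; trivial|].
    rewrite E; unfold k; field; repeat split; trivial; lra. }
  assert (Hc : x c <> 0) by (apply H; lra).
  transitivity (x c * (t c / x c + k * p c / x c + k * c - k * c) - k * p c).
  - field; trivial.
  - rewrite <- E; ring.
Qed.

(* [x x'] has derivative [- 2 - p^2 / x^4], so [x^2 / 2] is strictly concave. *)
Lemma run_duration a c :
  a <= c -> (forall s, a <= s <= c -> I s /\ x s <> 0) ->
  c < a + (Rabs (p a / x a) + x a ^ 2 + 1).
Proof.
  intros Hac H.
  (* First integration of the concavity estimate; note [p / x = x x']. *)
  assert (Q : forall s, a <= s <= c -> p s / x s <= p a / x a - 2 * (s - a)).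
  { intros s Hs.
    enough (- (p a / x a) - 2 * a <= - (p s / x s) - 2 * s) by lra.
    apply (derive_nonneg_le (fun s => - (p s / x s) - 2 * s) (fun s => p s ^ 2 / x s ^ 4)); [lra|].
    intros r Hr; destruct (H r ltac:(lra)) as [Ir Hx].
    assert (Dx := is_x r Ir Hx); assert (Dp := is_p r Ir Hx).
    split.
    - evar_last.
      { auto_derive.
        - repeat split; trivial; eexists; eassumption.
        - reflexivity. }
      rewrite (is_derive_unique _ _ _ Dx : Derive (fun y => x y) r = _),
        (is_derive_unique _ _ _ Dp : Derive (fun y => p y) r = _); field; trivial.
    - replace (p r ^ 2 / x r ^ 4) with ((p r / x r ^ 2) ^ 2) by (field; trivial).
      apply pow2_ge_0. }
  (* Second integration: [x^2 / 2] stays below a downward parabola, which is negative once [c - a]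
     reaches the claimed bound. *)
  assert (X : x c ^ 2 / 2 <= x a ^ 2 / 2 + p a / x a * (c - a) - (c - a) ^ 2).
  { enough (p a / x a * (a - a) - (a - a) ^ 2 - x a ^ 2 / 2
            <= p a / x a * (c - a) - (c - a) ^ 2 - x c ^ 2 / 2) by lra.
    apply (derive_nonneg_le (fun s => p a / x a * (s - a) - (s - a) ^ 2 - x s ^ 2 / 2)
             (fun s => p a / x a - 2 * (s - a) - p s / x s)); [lra|].
    intros r Hr; destruct (H r ltac:(lra)) as [Ir Hx].
    assert (Dx := is_x r Ir Hx).
    split; [|generalize (Q r Hr); lra].
    evar_last.
    { auto_derive.
      - repeat split; trivial; eexists; eassumption.
      - reflexivity. }
    rewrite (is_derive_unique _ _ _ Dx : Derive (fun y => x y) r = _); field; split; trivial; apply H; lra. }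
  generalize (Rle_abs (p a / x a)) (Rabs_pos (p a / x a)) (pow2_ge_0 (x a)) (pow2_ge_0 (x c)).
  intros. apply Rnot_le_lt; intros Hle.
  set (q := p a / x a) in *; set (X2 := x a ^ 2) in *; set (l := c - a) in *.
  assert (Rabs q + X2 + 1 <= l) by (unfold l; lra).
  assert (q * l <= Rabs q * l) by (apply Rmult_le_compat_r; lra).
  nra.
Qed.

(** The point [c] is the supremum of the [s] in [[a, z]] with [x > 0] on [[a, s]]. Left continuity
    gives [x c >= 0], while [x c > 0] would let positivity continue past [c]. *)
Lemma first_zero a z :
  I a -> I z -> a <= z -> 0 < x a -> x z <= 0 ->
  exists c, a < c /\ I c /\ x c = 0 /\ forall s, a <= s < c -> 0 < x s.
Proof.
  intros Ia Iz Haz Hxa Hxz.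
  pose (E := fun s => a <= s <= z /\ forall r, a <= r <= s -> 0 < x r).
  assert (Ea : E a).
  { split; [lra|]; intros r Hr; replace r with a by lra; trivial. }
  destruct (completeness E) as [c [Hub Hleast]].
  { exists z; intros s [Hs _]; lra. }
  { exists a; trivial. }
  assert (Hac : a <= c) by (apply Hub; trivial).
  assert (Hcz : c <= z) by (apply Hleast; intros s [Hs _]; lra).
  assert (Ic : I c) by (apply (af_convex _ _ _ _ _ _ F a z); trivial; lra).
  assert (Hpos : forall s, a <= s < c -> 0 < x s).
  { intros s Hs; apply NNPP; intros Hn.
    assert (c <= s); [|lra].
    apply Hleast; intros r [Hr Hr']; apply Rnot_lt_le; intros Hsr.
    apply Hn, Hr'; lra. }
  assert (Hnonneg : 0 <= x c).
  { destruct (Req_dec a c) as [<-|Hne]; [lra|].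
    apply Ropp_le_cancel; rewrite Ropp_0.
    apply (continuous_left_le (fun s => - x s) a c); [lra| |].
    - apply @continuous_opp, (af_cont_x _ _ _ _ _ _ F _ Ic).
    - intros s Hs; specialize (Hpos s Hs); lra. }
  assert (Hxc : x c = 0).
  { apply Rle_antisym; trivial; apply Rnot_lt_le; intros Hlt.
    destruct (continuous_pt_eps x c (x c) (af_cont_x _ _ _ _ _ _ F _ Ic) Hlt) as [d Hd].
    assert (Hd0 := cond_pos d).
    assert (Hnear : forall s, c <= s < c + d -> 0 < x s).
    { intros s Hs; assert (Hr : Rabs (s - c) < d) by (apply Rabs_def1; lra).
      specialize (Hd s Hr); apply Rabs_def2 in Hd; lra. }
    destruct (Rlt_dec z (c + d)) as [Hz|Hz].
    - specialize (Hnear z); lra.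
    - assert (c + d / 2 <= c); [|lra].
      apply Hub; split; [lra|].
      intros r Hr; destruct (Rlt_dec r c); [apply Hpos|apply Hnear]; lra. }
  exists c; repeat split; trivial.
  destruct (Req_dec a c) as [<-|Hne]; lra.
Qed.

(** Otherwise [run_duration] bounds [I] on the right, and both coordinates converge at its supremum
    [h], contrary to [no_right_limit]. *)
Lemma positive_run_ends a :
  no_right_limit I x t -> I a -> 0 < x a -> exists z, a <= z /\ I z /\ x z <= 0.
Proof.
  intros Hlim Ia Hxa; apply NNPP; intros Hno.
  assert (Hpos : forall s, a <= s -> I s -> 0 < x s).
  { intros s Has Is; apply Rnot_le_lt; intros Hle; apply Hno; exists s; auto. }
  destruct (completeness I) as [h [Hub Hleast]].
  { exists (a + (Rabs (p a / x a) + x a ^ 2 + 1)); intros s Is.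
    destruct (Rle_dec a s) as [Has|Has].
    - apply Rlt_le, run_duration; trivial.
      intros r Hr; assert (Ir : I r) by (apply (af_convex _ _ _ _ _ _ F a s); trivial).
      split; trivial; generalize (Hpos r (proj1 Hr) Ir); lra.
    - generalize (Rabs_pos (p a / x a)) (pow2_ge_0 (x a)); lra. }
  { exists a; trivial. }
  assert (Hh : ~ I h).
  { intros Ih; destruct (af_open _ _ _ _ _ _ F h Ih) as [d Hd].
    assert (Hd0 := cond_pos d).
    assert (h + d / 2 <= h); [|lra].
    apply Hub, Hd; replace (h + d / 2 - h) with (d / 2) by ring; apply Rabs_def1; lra. }
  assert (Hah : a < h).
  { destruct (Hub a Ia) as [|E]; trivial; subst; contradiction. }
  assert (HI : forall s, a <= s < h -> I s).
  { intros s Hs; apply NNPP; intros Hn.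
    assert (h <= s); [|lra].
    apply Hleast; intros r Ir; apply Rnot_lt_le; intros Hsr; apply Hn.
    apply (af_convex _ _ _ _ _ _ F a r); trivial; lra. }
  assert (Hrun : forall s, a <= s < h -> I s /\ x s <> 0).
  { intros s Hs; split; [apply HI; trivial|].
    generalize (Hpos s (proj1 Hs) (HI s Hs)); lra. }
  (* The fourth power of the amplitude [D] of the motion. *)
  set (D4 := beta * m a ^ 2).
  assert (En : forall s, a <= s < h -> p s ^ 2 + x s ^ 4 = D4).
  { intros s Hs; destruct (Hrun s Hs) as [Is Hx].
    rewrite (energy s Is Hx), (run_momentum a s); trivial; [lra|].
    intros; apply Hrun; lra. }
  (* Either [x <= 1], or [x <= x^4 <= D4]. *)
  assert (Hxb : forall s, a <= s < h -> 0 < x s <= 1 + D4).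
  { intros s Hs; split; [apply Hpos; [lra|apply HI; trivial]|].
    generalize (En s Hs) (pow2_ge_0 (p s)); intros E1 E2.
    generalize (Hpos s (proj1 Hs) (HI s Hs)); intros Hx.
    destruct (Rle_dec (x s) 1); [|assert (x s <= x s ^ 4)].
    - generalize (pow2_ge_0 (x s ^ 2)); intros; nra.
    - assert (1 <= x s ^ 3) by (apply pow_R1_Rle; lra); nra.
    - lra. }
  (* As [p' = - 2 x] is bounded, [p] is Lipschitz and has a limit; the limits of [x] and [t] are
     then derived from it. *)
  destruct (lipschitz_left_limit p (2 * (1 + D4)) a h Hah) as [lp Lp].
  { intros r s Hrs Hs.
    apply Rabs_le; split.
    - enough (p r + 2 * (1 + D4) * r <= p s + 2 * (1 + D4) * s) by lra.
      apply (derive_nonneg_le (fun y => p y + 2 * (1 + D4) * y)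
               (fun y => - 2 * x y + 2 * (1 + D4))); [lra|].
      intros y Hy; split.
      + evar_last; [apply @is_derive_plus|].
        * apply is_p; apply Hrun; lra.
        * auto_derive; [trivial|reflexivity].
        * unfold plus; simpl; ring.
      + generalize (Hxb y); lra.
    - enough (- p r + 2 * (1 + D4) * r <= - p s + 2 * (1 + D4) * s) by lra.
      apply (derive_nonneg_le (fun y => - p y + 2 * (1 + D4) * y)
               (fun y => 2 * x y + 2 * (1 + D4))); [lra|].
      intros y Hy; split.
      + evar_last; [apply @is_derive_plus|].
        * apply @is_derive_opp, is_p; apply Hrun; lra.
        * auto_derive; [trivial|reflexivity].
        * unfold plus, opp; simpl; ring.
      + generalize (Hxb y); lra. }
  assert (Hloc : forall P : R -> Prop, (forall s, a <= s < h -> P s) -> at_left h P).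
  { intros P HP; exists (mkposreal (h - a) ltac:(lra)); intros y Hy Hyh; apply HP.
    unfold ball in Hy; simpl in Hy; unfold AbsRing_ball, abs, minus, plus, opp in Hy.
    simpl in Hy; apply Rabs_def2 in Hy; lra. }
  assert (Hlift : forall (f : R -> R) g, continuous f lp ->
    (forall s, a <= s < h -> f (p s) = g s) -> filterlim g (at_left h) (locally (f lp))).
  { intros f g Hf Hg; apply filterlim_ext_loc with (fun s => f (p s)); [apply Hloc, Hg|].
    exact (filterlim_comp _ _ _ p f _ _ _ Lp Hf). }
  (* By positivity, [x] is the fourth root of [D4 - p^2]. *)
  assert (Lx : filterlim x (at_left h) (locally (sqrt (sqrt (D4 - lp ^ 2))))).
  { apply (Hlift (fun q => sqrt (sqrt (D4 - q ^ 2)))).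
    - apply (continuous_comp (fun q => sqrt (D4 - q ^ 2)) sqrt); [|apply continuous_sqrt].
      apply (continuous_comp (fun q => D4 - q ^ 2) sqrt); [|apply continuous_sqrt].
      apply (ex_derive_continuous (fun q => D4 - q ^ 2)); auto_derive; trivial.
    - intros s Hs; replace (D4 - p s ^ 2) with ((x s ^ 2) ^ 2) by (rewrite <- (En s Hs); ring).
      rewrite !sqrt_pow2; trivial; [generalize (Hxb s Hs); lra|apply pow2_ge_0]. }
  set (k := / (beta * m a)).
  set (C := t a / x a + k * p a / x a + k * a).
  set (lx := sqrt (sqrt (D4 - lp ^ 2))) in *.
  apply (Hlim h a lx (lx * (C - k * h) - k * lp)); trivial.
  (* The first integral expresses [t] through [x], [p] and proper time, all of which converge. *)
  apply filterlim_ext_loc with (fun s => x s * (C - k * s) + opp (k * p s)).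
  { apply Hloc; intros s Hs; symmetry; apply (run_first_integral a s); [lra|].
    intros; apply Hrun; lra. }
  assert (Lk : filterlim (fun s => C - k * s) (at_left h) (locally (C - k * h))).
  { apply (filterlim_filter_le_1 _ (filter_le_within (F := locally h) (fun s => s < h))).
    apply (ex_derive_continuous (fun s => C - k * s)); auto_derive; trivial. }
  apply (filterlim_comp_2 (G := locally (lx * (C - k * h))) (H := locally (- (k * lp)))).
  - apply (filterlim_comp_2 (G := locally lx) (H := locally (C - k * h))); trivial.
    apply (filterlim_mult lx (C - k * h)).
  - apply (Hlift (fun q => - (k * q))); [|reflexivity].
    apply (ex_derive_continuous (fun q => - (k * q))); auto_derive; trivial.
  - apply (filterlim_plus (lx * (C - k * h)) (- (k * lp))).
Qed.

(** On the axis the first integral reads [t = - k p], and the energy identity [p^2 = beta m^2] then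
    gives [t^2 = 1 / beta]. As [x] falls to zero the limit of [p] is negative, so [t] has the sign
    of [k], which is that of [m]. *)
Lemma run_end_value a c :
  a < c -> I a -> I c -> x c = 0 -> (forall s, a <= s < c -> 0 < x s) ->
  0 < t c * m a /\ t c ^ 2 = / beta.
Proof.
  intros Hac Ia Ic Hxc Hpos.
  assert (HI : forall s, a <= s < c -> I s /\ x s <> 0).
  { intros s Hs; split; [apply (af_convex _ _ _ _ _ _ F a c); trivial; lra|].
    generalize (Hpos s Hs); lra. }
  assert (Hm : m a <> 0) by (apply angular_momentum_neq_0; apply HI; lra).
  set (k := / (beta * m a)).
  assert (Hk : k <> 0).
  { unfold k; apply Rinv_neq_0_compat, Rmult_integral_contrapositive_currified; lra. }
  set (C := t a / x a + k * p a / x a + k * a).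
  (* The flow says nothing about [p] at [c]. Solving the first integral for [p] gives a function
     that is continuous there and agrees with [p] before. *)
  pose (P := fun s => / k * (x s * (C - k * s) - t s)).
  assert (HP : forall s, a <= s < c -> P s = p s).
  { intros s Hs; unfold P, C, k; rewrite (run_first_integral a s); [fold k; field; repeat split; trivial|lra|].
    - apply HI; lra.
    - intros; apply HI; lra. }
  assert (HPc : P c = - (t c / k)) by (unfold P; rewrite Hxc; field; trivial).
  assert (Pcont : continuous P c).
  { unfold P; apply (continuous_mult (fun _ => / k)
      (fun s => x s * (C - k * s) - t s)); [apply continuous_const|].
    apply (continuous_minus (fun s => x s * (C - k * s)) t).
    - apply (continuous_mult x (fun s => C - k * s)).
      + apply (af_cont_x _ _ _ _ _ _ F _ Ic).
      + apply (ex_derive_continuous (fun s => C - k * s)); auto_derive; trivial.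
    - apply (af_cont_t _ _ _ _ _ _ F _ Ic). }
  assert (E : P c ^ 2 + x c ^ 4 = beta * m a ^ 2).
  { apply (continuous_left_eq (fun s => P s ^ 2 + x s ^ 4) a); trivial.
    - apply (continuous_plus (fun s => P s ^ 2) (fun s => x s ^ 4)).
      + apply (continuous_comp P (fun y => y ^ 2)); trivial.
        apply (ex_derive_continuous (fun y => y ^ 2)); auto_derive; trivial.
      + apply (continuous_comp x (fun y => y ^ 4)).
        * apply (af_cont_x _ _ _ _ _ _ F _ Ic).
        * apply (ex_derive_continuous (fun y => y ^ 4)); auto_derive; trivial.
    - intros s Hs; rewrite (HP s Hs), <- (run_momentum a s); [|lra|intros; apply HI; lra].
      apply energy; apply HI; trivial. }
  split.
  (* If [p >= 0] throughout, [x] would be nondecreasing and could not reach zero. *)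
  - assert (Hneg : exists s2, a <= s2 < c /\ p s2 < 0).
    { apply NNPP; intros Hno.
      assert (x a <= 0); [|generalize (Hpos a ltac:(lra)); lra].
      rewrite <- Hxc; apply Ropp_le_cancel.
      apply (continuous_left_le (fun s => - x s) a); trivial.
      { apply @continuous_opp, (af_cont_x _ _ _ _ _ _ F _ Ic). }
      intros s Hs; apply Ropp_le_contravar.
      apply (derive_nonneg_le x (fun r => p r / x r ^ 2)); [lra|].
      intros r Hr; destruct (HI r ltac:(lra)) as [Ir Hx]; split; [apply is_x; trivial|].
      apply Rmult_le_pos; [|apply Rlt_le, Rinv_0_lt_compat, pow2_gt_0; trivial].
      apply Rnot_lt_le; intros Hp; apply Hno; exists r; split; trivial; lra. }
    destruct Hneg as [s2 [Hs2 Hp2]].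
    (* From [s2] on, [p' = - 2 x < 0] keeps [p] below its negative value there. *)
    assert (Hle : P c <= p s2).
    { apply continuous_left_le with s2; trivial; [lra|].
      intros s Hs; rewrite HP by lra; apply Ropp_le_cancel.
      apply (derive_nonneg_le (fun r => - p r) (fun r => 2 * x r)); [lra|].
      intros r Hr; split; [|generalize (Hpos r); lra].
      evar_last; [apply @is_derive_opp, is_p; apply HI; lra|unfold opp; simpl; ring]. }
    assert (Hprod : 0 < t c / k) by lra.
    replace (t c * m a) with (t c / k * / beta) by (unfold k; field; repeat split; trivial; lra).
    apply Rmult_lt_0_compat; trivial; apply Rinv_0_lt_compat; trivial.
  - rewrite HPc, Hxc in E.
    replace (t c ^ 2) with (((- (t c / k)) ^ 2 + 0 ^ 4) * k ^ 2) by (field; trivial).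
    rewrite E; unfold k; field; repeat split; trivial; lra.
Qed.

End Run.

(** * Complete flows and full arcs between consecutive crossings *)

Record complete_axis_flow (beta : R) (I : R -> Prop) (x t p m : R -> R) : Prop := {
  caf_flow : axis_flow beta I x t p m;
  caf_right : no_right_limit I x t;
  caf_left : no_right_limit (fun s => I (- s)) (fun s => x (- s)) (fun s => t (- s))
}.

Lemma complete_axis_flow_reverse beta I x t p m :
  complete_axis_flow beta I x t p m ->
  complete_axis_flow beta (fun s => I (- s)) (fun s => x (- s)) (fun s => t (- s))
    (fun s => - p (- s)) (fun s => - m (- s)).
Proof.
  intros [F HR HL]; constructor; trivial.
  - apply axis_flow_reverse; trivial.
  - intros h s0 lx lt Hs HI Hh Lx Lt; apply (HR h s0 lx lt); trivial.
    + intros s Hs'; rewrite <- (Ropp_involutive s); apply HI; trivial.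
    + rewrite <- (Ropp_involutive h); trivial.
    + apply filterlim_ext with (2 := Lx); intros; rewrite Ropp_involutive; trivial.
    + apply filterlim_ext with (2 := Lt); intros; rewrite Ropp_involutive; trivial.
Qed.

Definition sign_unit (s : R) : Prop := s = 1 \/ s = -1.

(** Constancy of [m] on the arc gives it one sign [mu]. The equation [t^2 = 1 / beta] leaves two
    values of [t c], and [0 < t c * m s] selects the one with sign [mu]. *)
Lemma positive_half_arc beta I x t p m s :
  0 < beta -> axis_flow beta I x t p m -> no_right_limit I x t -> I s -> 0 < x s ->
  exists c mu, s < c /\ I c /\ x c = 0 /\ sign_unit mu /\ t c = mu / sqrt beta /\
    forall r, s <= r < c -> 0 < x r /\ 0 < mu * m r.
Proof.
  intros Hb F HR Is Hx.
  destruct (positive_run_ends beta I x t p m Hb F s HR Is Hx) as [z (Hsz & Iz & Hxz)].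
  destruct (first_zero beta I x t p m F s z Is Iz Hsz Hx Hxz) as [c (Hsc & Ic & Hxc & Hpos)].
  destruct (run_end_value beta I x t p m Hb F s c Hsc Is Ic Hxc Hpos) as [Hsgn Hsq].
  assert (Hm : forall r, s <= r < c -> m r = m s).
  { intros r Hr; apply (run_momentum beta I x t p m F); [lra|].
    intros y Hy; split; [apply (af_convex _ _ _ _ _ _ F s c); trivial; lra|].
    generalize (Hpos y); lra. }
  assert (Hq : 0 < sqrt beta) by (apply sqrt_lt_R0; trivial).
  assert (Hfac : (t c - / sqrt beta) * (t c + / sqrt beta) = 0).
  { transitivity (t c ^ 2 - / (sqrt beta * sqrt beta)); [field; lra|].
    rewrite sqrt_sqrt, Hsq by lra; ring. }
  assert (Hq' : 0 < / sqrt beta) by (apply Rinv_0_lt_compat; trivial).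
  apply Rmult_integral in Hfac; destruct Hfac as [Ht|Ht].
  - exists c, 1; repeat split; trivial; [left; trivial|lra|apply Hpos; trivial|].
    rewrite Hm by trivial; replace (t c) with (/ sqrt beta) in Hsgn by lra; nra.
  - exists c, (-1); repeat split; trivial; [right; trivial|lra|apply Hpos; trivial|].
    rewrite Hm by trivial; replace (t c) with (- / sqrt beta) in Hsgn by lra; nra.
Qed.

(** The case [sigma = -1] is the reflected curve: [t] changes sign and [m] does not, whence the
    factor [sigma] in the end value. *)
Lemma half_arc beta I x t p m s sigma :
  0 < beta -> axis_flow beta I x t p m -> no_right_limit I x t -> I s ->
  sign_unit sigma -> 0 < sigma * x s ->
  exists c mu, s < c /\ I c /\ x c = 0 /\ sign_unit mu /\ t c = sigma * mu / sqrt beta /\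
    forall r, s <= r < c -> 0 < sigma * x r /\ 0 < mu * m r.
Proof.
  intros Hb F HR Is [->| ->] Hx.
  - destruct (positive_half_arc beta I x t p m s) as (c & mu & H1 & H2 & H3 & H4 & H5 & H6);
      trivial; [lra|].
    exists c, mu; repeat split; trivial; [lra| |]; destruct (H6 r); trivial; lra.
  - destruct (positive_half_arc beta I (fun r => - x r) (fun r => - t r) (fun r => - p r) m s)
      as (c & mu & H1 & H2 & H3 & H4 & H5 & H6); trivial;
      [apply axis_flow_flip; trivial|apply no_right_limit_flip; trivial|lra|].
    exists c, mu; repeat split; trivial; [lra|lra| |]; destruct (H6 r); trivial; lra.
Qed.

(** [sigma] is the sign of [x] on the arc and [mu] the sign of the constant of
    motion. *)
Record arc (beta : R) (I : R -> Prop) (x t m : R -> R) (mu sigma a c : R) : Prop := {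
  arc_lt : a < c;
  arc_in_l : I a;
  arc_in_r : I c;
  arc_x_l : x a = 0;
  arc_x_r : x c = 0;
  arc_t_l : t a = - (sigma * mu / sqrt beta);
  arc_t_r : t c = sigma * mu / sqrt beta;
  arc_interior : forall s, a < s < c -> 0 < sigma * x s /\ 0 < mu * m s
}.

Lemma arc_reverse beta I x t m mu sigma a c :
  arc beta I x t m mu sigma a c ->
  arc beta (fun s => I (- s)) (fun s => x (- s)) (fun s => t (- s)) (fun s => - m (- s))
    (- mu) sigma (- c) (- a).
Proof.
  intros []; constructor; rewrite ?Ropp_involutive; trivial; [lra|lra|lra|].
  intros s Hs; destruct (arc_interior0 (- s)); lra.
Qed.

Lemma arc_unreverse beta I x t m mu sigma a c :
  arc beta (fun s => I (- s)) (fun s => x (- s)) (fun s => t (- s)) (fun s => - m (- s))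
    (- mu) sigma (- c) (- a) ->
  arc beta I x t m mu sigma a c.
Proof.
  intros []; rewrite ?Ropp_involutive in *; constructor; trivial; [lra|lra|lra|].
  intros s Hs; destruct (arc_interior0 (- s)) as [H1 H2]; [lra|].
  rewrite Ropp_involutive in *; lra.
Qed.

(** The half arc after [s] is glued to the half arc of the reversed curve. *)
Lemma arc_through beta I x t p m s sigma :
  0 < beta -> complete_axis_flow beta I x t p m -> I s -> sign_unit sigma ->
  0 < sigma * x s ->
  exists a c mu, a < s < c /\ sign_unit mu /\ arc beta I x t m mu sigma a c.
Proof.
  intros Hb CF Is Hsig Hx; assert (CF' := complete_axis_flow_reverse _ _ _ _ _ _ CF).
  destruct CF as [F HR _], CF' as [F' HL _].
  destruct (half_arc beta I x t p m s sigma) as (c & mu & H1 & H2 & H3 & H4 & H5 & H6); trivial.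
  destruct (half_arc _ _ _ _ _ _ (- s) sigma Hb F' HL) as (a & nu & K1 & K2 & K3 & K4 & K5 & K6);
    rewrite ?Ropp_involutive; trivial.
  (* The reversed curve carries [- m], so the two signs compare at [s]. *)
  assert (Hnu : nu = - mu).
  { destruct (H6 s ltac:(lra)) as [_ M1]; destruct (K6 (- s) ltac:(lra)) as [_ M2].
    rewrite Ropp_involutive in M2; destruct H4 as [->| ->], K4 as [->| ->]; lra. }
  subst nu.
  exists (- a), c, mu; split; [lra|split; trivial]; constructor; trivial; [lra| |].
  - rewrite K5; unfold Rdiv; ring.
  - intros r Hr; destruct (Rle_dec s r); [apply H6; lra|].
    destruct (K6 (- r) ltac:(lra)) as [M1 M2]; rewrite Ropp_involutive in *; lra.
Qed.

(** Strict monotonicity of [x] across [c] reverses its sign, so an arc of sign [- sigma] passes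
    through a point just after [c]. It remains to see that it starts at [c] and has the same
    [mu]. *)
Lemma arc_next beta I x t p m mu sigma a c :
  0 < beta -> complete_axis_flow beta I x t p m -> sign_unit sigma ->
  arc beta I x t m mu sigma a c -> exists d, arc beta I x t m mu (- sigma) c d.
Proof.
  intros Hb CF Hsig A; assert (F := caf_flow _ _ _ _ _ _ CF); destruct A.
  destruct (af_open _ _ _ _ _ _ F c arc_in_r0) as [d1 Hd1].
  destruct (af_cross _ _ _ _ _ _ F c arc_in_r0 arc_x_r0) as [d2 Hd2].
  assert (P1 := cond_pos d1); assert (P2 := cond_pos d2).
  set (e := Rmin d1 d2 / 2).
  assert (He : 0 < e /\ e < d1 /\ e < d2).
  { unfold e; generalize (Rmin_l d1 d2) (Rmin_r d1 d2) (Rmin_pos d1 d2 P1 P2); lra. }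
  assert (Hnear : forall r, c - e <= r <= c + e -> Rabs (r - c) < d2).
  { intros r Hr; apply Rabs_def1; lra. }
  assert (Ir : I (c + e)).
  { apply Hd1; apply Rabs_def1; lra. }
  set (s := Rmax (c - e) ((a + c) / 2)).
  assert (Hs : c - e <= s < c /\ a < s).
  { unfold s; repeat split; [apply Rmax_l|apply Rmax_lub_lt; lra|].
    apply Rlt_le_trans with ((a + c) / 2); [lra|apply Rmax_r]. }
  destruct (arc_interior0 s ltac:(lra)) as [Hxs _].
  assert (Hright : forall r, c < r <= c + e -> 0 < - sigma * x r).
  { intros r Hr.
    destruct Hd2 as [Hd2|Hd2];
      assert (Q1 := Hd2 s c (Hnear s ltac:(lra)) (Hnear c ltac:(lra)) ltac:(lra));
      assert (Q2 := Hd2 c r (Hnear c ltac:(lra)) (Hnear r ltac:(lra)) ltac:(lra));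
      destruct Hsig as [->| ->]; lra. }
  assert (Hsig' : sign_unit (- sigma)) by (destruct Hsig as [->| ->]; [right|left]; lra).
  destruct (arc_through beta I x t p m (c + e) (- sigma)) as (a' & d & mu' & Had & Hmu' & A');
    trivial; [apply Hright; lra|].
  (* If [a' < c], then [c] would be a zero inside the new arc; if [a' > c], then [a'] would be a
     zero in [(c, c + e]]. *)
  assert (Ea : a' = c).
  { destruct A'; destruct (Rtotal_order a' c) as [Hlt|[?|Hgt]]; trivial; exfalso.
    - destruct (arc_interior1 c ltac:(lra)) as [H _]; rewrite arc_x_r0 in H; lra.
    - specialize (Hright a' ltac:(lra)); rewrite arc_x_l1 in Hright; lra. }
  subst a'.
  (* The value [t c], read as right end of one arc and left end of the other, is
     [sigma mu / sqrt beta] and [sigma mu' / sqrt beta]. *)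
  assert (Emu : mu' = mu).
  { destruct A'; rewrite arc_t_r0 in arc_t_l1.
    assert (Hq : 0 < sqrt beta) by (apply sqrt_lt_R0; trivial).
    assert (E : sigma * mu = sigma * mu').
    { replace (sigma * mu) with (sigma * mu / sqrt beta * sqrt beta) by (field; lra).
      rewrite arc_t_l1; field; lra. }
    destruct Hsig as [->| ->]; lra. }
  subst mu'; exists d; trivial.
Qed.

Lemma arc_prev beta I x t p m mu sigma a c :
  0 < beta -> complete_axis_flow beta I x t p m -> sign_unit sigma ->
  arc beta I x t m mu sigma a c -> exists d, arc beta I x t m mu (- sigma) d a.
Proof.
  intros Hb CF Hsig A.
  destruct (arc_next _ _ _ _ _ _ _ _ _ _ Hb (complete_axis_flow_reverse _ _ _ _ _ _ CF)
    Hsig (arc_reverse _ _ _ _ _ _ _ _ _ A)) as [d Hd].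
  exists (- d); apply arc_unreverse; rewrite Ropp_involutive; trivial.
Qed.

(** * Chaining the arcs *)

(** Dependent choice with an indexed invariant. *)
Lemma nat_chain (A : Type) (Q : nat -> A -> Prop) (link : A -> A -> Prop) (q0 : A) :
  Q 0%nat q0 -> (forall n q, Q n q -> exists q', Q (S n) q' /\ link q q') ->
  exists f : nat -> A, f 0%nat = q0 /\ forall n, Q n (f n) /\ link (f n) (f (S n)).
Proof.
  intros H0 HS.
  assert (Hg : forall nq : nat * A, exists q' : A,
    Q (fst nq) (snd nq) -> Q (S (fst nq)) q' /\ link (snd nq) q').
  { intros [n q]; destruct (classic (Q n q)) as [Hq|Hq].
    - destruct (HS n q Hq) as [q' Hq']; exists q'; auto.
    - exists q; contradiction. }
  destruct (choice _ Hg) as [g Hg'].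
  (* Where [Q] fails, [g] is unconstrained; the iteration from [q0] never meets such a pair. *)
  pose (f := nat_rect (fun _ => A) q0 (fun n q => g (n, q))).
  assert (Hf : forall n, Q n (f n)).
  { induction n as [|n IH]; trivial; exact (proj1 (Hg' (n, f n) IH)). }
  exists f; split; trivial; intros n; split; trivial; exact (proj2 (Hg' (n, f n) (Hf n))).
Qed.

(** Two one-sided chains of intervals, stored as pairs of endpoints, are glued at index [0], where
    both start from [(a0, c0)]; [theta] reads off left endpoints. *)
Lemma Z_chain (P : Z -> R -> R -> Prop) (a0 c0 : R) :
  P 0%Z a0 c0 ->
  (forall k a c, P k a c -> exists d, P (k + 1)%Z c d) ->
  (forall k a c, P k a c -> exists d, P (k - 1)%Z d a) ->
  exists theta : Z -> R, forall k, P k (theta k) (theta (k + 1)%Z).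
Proof.
  intros H0 Hnext Hprev.
  destruct (nat_chain (R * R) (fun n q => P (Z.of_nat n) (fst q) (snd q))
    (fun q q' => fst q' = snd q) (a0, c0)) as [f [f0 Hf]]; trivial.
  { intros n q Hq; destruct (Hnext _ _ _ Hq) as [d Hd]; exists (snd q, d); split; trivial.
    rewrite Nat2Z.inj_succ; exact Hd. }
  destruct (nat_chain (R * R) (fun n q => P (- Z.of_nat n)%Z (fst q) (snd q))
    (fun q q' => snd q' = fst q) (a0, c0)) as [g [g0 Hg]]; trivial.
  { intros n q Hq; destruct (Hprev _ _ _ Hq) as [d Hd]; exists (d, fst q); split; trivial.
    replace (- Z.of_nat (S n))%Z with (- Z.of_nat n - 1)%Z by lia; exact Hd. }
  pose (theta := fun k => if Z.leb 0 k then fst (f (Z.to_nat k)) else fst (g (Z.to_nat (- k)))).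
  assert (T1 : forall n, theta (Z.of_nat n) = fst (f n)).
  { intros n; unfold theta; destruct (Z.leb_spec 0 (Z.of_nat n)); [|lia].
    rewrite Nat2Z.id; trivial. }
  assert (T2 : forall n, theta (- Z.of_nat n)%Z = fst (g n)).
  { intros [|n]; [change (- Z.of_nat 0)%Z with (Z.of_nat 0); rewrite T1, f0, g0; trivial|].
    unfold theta; destruct (Z.leb_spec 0 (- Z.of_nat (S n))); [lia|].
    rewrite Z.opp_involutive, Nat2Z.id; trivial. }
  exists theta; intros k; destruct (Z.le_gt_cases 0 k) as [Hk|Hk].
  - rewrite <- (Z2Nat.id k Hk); set (n := Z.to_nat k).
    replace (Z.of_nat n + 1)%Z with (Z.of_nat (S n)) by lia.
    rewrite !T1; destruct (Hf n) as [Hn ->]; trivial.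
  - set (n := Z.to_nat (- k - 1)); replace k with (- Z.of_nat (S n))%Z by lia.
    replace (- Z.of_nat (S n) + 1)%Z with (- Z.of_nat n)%Z by lia.
    rewrite !T2; destruct (Hg n) as [_ <-]; apply Hg.
Qed.

(** A bound [z] in [I] would make [u] converge to its supremum [L], in [I] by convexity. Continuity
    of [t] at [L] contradicts jumps of size at least [eps]. *)
Lemma oscillation_unbounded (I : R -> Prop) (t : R -> R) (u : nat -> R) (eps z : R) :
  (forall s, I s -> continuous t s) ->
  (forall a c s, I a -> I c -> a <= s <= c -> I s) ->
  (forall n, I (u n)) -> (forall n, u n < u (S n)) ->
  0 < eps -> (forall n, eps <= Rabs (t (u (S n)) - t (u n))) ->
  I z -> exists n, z < u n.
Proof.
  intros Ht Hconv HI Hu He Hosc Iz; apply NNPP; intros Hno.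
  assert (Hz : forall n, u n <= z).
  { intros n; apply Rnot_lt_le; intros H; apply Hno; exists n; trivial. }
  destruct (completeness (fun s => exists n, s = u n)) as [L [Hub Hleast]].
  { exists z; intros s [n ->]; trivial. }
  { exists (u 0%nat), 0%nat; trivial. }
  assert (HuL : forall n, u n <= L) by (intros n; apply Hub; exists n; trivial).
  assert (HL : L <= z) by (apply Hleast; intros s [n ->]; trivial).
  assert (IL : I L) by (apply (Hconv (u 0%nat) z); auto).
  destruct (continuous_pt_eps t L (eps / 2) (Ht L IL) ltac:(lra)) as [d Hd].
  assert (Hd0 := cond_pos d).
  assert (Hn : exists n, L - d < u n).
  { apply NNPP; intros Hn; assert (L <= L - d); [|lra].
    apply Hleast; intros s [n ->]; apply Rnot_lt_le; intros H; apply Hn; exists n; trivial. }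
  destruct Hn as [n Hn]; generalize (HuL n) (HuL (S n)) (Hu n); intros.
  assert (Q1 : Rabs (u n - L) < d) by (apply Rabs_def1; lra).
  assert (Q2 : Rabs (u (S n) - L) < d) by (apply Rabs_def1; lra).
  apply Hd, Rabs_def2 in Q1; apply Hd, Rabs_def2 in Q2.
  specialize (Hosc n); revert Hosc; apply Rlt_not_le, Rabs_def1; lra.
Qed.

(** The index [j] advances until the next value exceeds [s], within [n] steps. *)
Lemma Z_bracket (theta : Z -> R) (s : R) (j : Z) (n : nat) :
  theta j <= s -> s < theta (j + Z.of_nat n)%Z ->
  exists k, theta k <= s < theta (k + 1)%Z.
Proof.
  revert j; induction n as [|n IH]; intros j Hj Hn.
  - rewrite Z.add_0_r in Hn; lra.
  - destruct (Rlt_le_dec s (theta (j + 1)%Z)) as [H|H]; [exists j; lra|].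
    apply (IH (j + 1)%Z); trivial.
    replace (j + 1 + Z.of_nat n)%Z with (j + Z.of_nat (S n))%Z by lia; trivial.
Qed.

Definition parity_sign (k : Z) : R := if Z.even k then 1 else -1.

Lemma parity_sign_unit k : sign_unit (parity_sign k).
Proof. unfold parity_sign; destruct (Z.even k); [left|right]; trivial. Qed.

Lemma parity_sign_succ k : parity_sign (k + 1)%Z = - parity_sign k.
Proof. unfold parity_sign; rewrite Z.even_add; destruct (Z.even k); simpl; lra. Qed.

Lemma parity_sign_pred k : parity_sign (k - 1)%Z = - parity_sign k.
Proof. unfold parity_sign; rewrite Z.even_sub; destruct (Z.even k); simpl; lra. Qed.

(** One arc is extended both ways with a common [mu]; the jumps of [t] then show that the arcs
    exhaust [I]. *)
Lemma complete_flow_arcs beta I x t p m :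
  0 < beta -> complete_axis_flow beta I x t p m ->
  exists mu theta, sign_unit mu /\
    (forall k, arc beta I x t m mu (parity_sign k) (theta k) (theta (k + 1)%Z)) /\
    (forall s, I s -> exists k, theta k <= s < theta (k + 1)%Z).
Proof.
  intros Hb CF; assert (F := caf_flow _ _ _ _ _ _ CF).
  (* Strict monotonicity at a crossing provides a nearby point off the axis. *)
  assert (Hstart : exists s, I s /\ x s <> 0).
  { destruct (af_inhabited _ _ _ _ _ _ F) as [s Is].
    destruct (Req_dec (x s) 0) as [Hx|Hx]; [|exists s; auto].
    destruct (af_open _ _ _ _ _ _ F s Is) as [d1 Hd1].
    destruct (af_cross _ _ _ _ _ _ F s Is Hx) as [d2 Hd2].
    assert (P1 := cond_pos d1); assert (P2 := cond_pos d2).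
    set (e := Rmin d1 d2 / 2).
    assert (He : 0 < e /\ e < d1 /\ e < d2).
    { unfold e; generalize (Rmin_l d1 d2) (Rmin_r d1 d2) (Rmin_pos d1 d2 P1 P2); lra. }
    exists (s + e); split; [apply Hd1, Rabs_def1; lra|].
    assert (Q1 : Rabs (s - s) < d2) by (apply Rabs_def1; lra).
    assert (Q2 : Rabs (s + e - s) < d2) by (apply Rabs_def1; lra).
    destruct Hd2 as [Hd2|Hd2]; specialize (Hd2 _ _ Q1 Q2 ltac:(lra)); lra. }
  destruct Hstart as [s [Is Hx]].
  (* Index [0] must carry a positive arc, to agree with [parity_sign]; a negative arc is replaced by
     its successor. *)
  assert (Hfirst : exists a c mu, sign_unit mu /\ arc beta I x t m mu 1 a c).
  { destruct (Rlt_le_dec 0 (x s)) as [Hpos|Hneg].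
    - destruct (arc_through beta I x t p m s 1) as (a & c & mu & _ & Hmu & A); trivial;
        [left; trivial|lra|exists a, c, mu; auto].
    - destruct (arc_through beta I x t p m s (-1)) as (a & c & mu & _ & Hmu & A); trivial;
        [right; trivial|lra|].
      destruct (arc_next beta I x t p m mu (-1) a c) as [d A']; trivial; [right; trivial|].
      exists c, d, mu; split; trivial; replace 1 with (- (-1)) by ring; trivial. }
  destruct Hfirst as (a0 & c0 & mu & Hmu & A0).
  destruct (Z_chain (fun k a c => arc beta I x t m mu (parity_sign k) a c) a0 c0)
    as [theta Htheta]; trivial.
  { intros k a c A; rewrite parity_sign_succ.
    apply (arc_next beta I x t p m mu _ a c); trivial; apply parity_sign_unit. }
  { intros k a c A; rewrite parity_sign_pred.
    apply (arc_prev beta I x t p m mu _ a c); trivial; apply parity_sign_unit. }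
  exists mu, theta; split; [trivial|split; [trivial|]].
  assert (Hq : 0 < / sqrt beta) by (apply Rinv_0_lt_compat, sqrt_lt_R0; trivial).
  (* The jump is exactly [2 / sqrt beta]; half of it suffices. *)
  assert (Hjump : forall k, / sqrt beta <= Rabs (t (theta (k + 1)%Z) - t (theta k))).
  { intros k; destruct (Htheta k); rewrite arc_t_l0, arc_t_r0; unfold Rdiv.
    destruct (parity_sign_unit k) as [->| ->], Hmu as [->| ->];
      (rewrite Rabs_right by lra; lra) || (rewrite Rabs_left by lra; lra). }
  intros r Ir.
  destruct (oscillation_unbounded I t (fun n => theta (Z.of_nat n)) (/ sqrt beta) r)
    as [n Hn]; trivial.
  { apply (af_cont_t _ _ _ _ _ _ F). }
  { apply (af_convex _ _ _ _ _ _ F). }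
  { intros n; apply (arc_in_l _ _ _ _ _ _ _ _ _ (Htheta (Z.of_nat n))). }
  { intros n; rewrite Nat2Z.inj_succ; apply (arc_lt _ _ _ _ _ _ _ _ _ (Htheta (Z.of_nat n))). }
  { intros n; rewrite Nat2Z.inj_succ; apply Hjump. }
  assert (F' := axis_flow_reverse _ _ _ _ _ _ F).
  assert (Hk : forall n, (- Z.of_nat (S n) + 1 = - Z.of_nat n)%Z) by (intros; lia).
  (* The reversed curve shows that the crossings also pass below [r]. *)
  destruct (oscillation_unbounded (fun s => I (- s)) (fun s => t (- s))
    (fun n => - theta (- Z.of_nat n)%Z) (/ sqrt beta) (- r)) as [j Hj]; trivial.
  { apply (af_cont_t _ _ _ _ _ _ F'). }
  { apply (af_convex _ _ _ _ _ _ F'). }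
  { intros j; rewrite Ropp_involutive; apply (arc_in_l _ _ _ _ _ _ _ _ _ (Htheta _)). }
  { intros j; generalize (arc_lt _ _ _ _ _ _ _ _ _ (Htheta (- Z.of_nat (S j))%Z)).
    rewrite Hk; lra. }
  { intros j; rewrite !Ropp_involutive, Rabs_minus_sym, <- Hk; apply Hjump. }
  { rewrite Ropp_involutive; trivial. }
  apply (Z_bracket theta r (- Z.of_nat j) (j + n)); [lra|].
  replace (- Z.of_nat j + Z.of_nat (j + n))%Z with (Z.of_nat n) by lia; trivial.
Qed.

(** * Inextendible geodesics and the conclusion *)

Lemma filterlim_pair_components (gam : R -> R * R) (G : (R -> Prop) -> Prop) (FG : Filter G) lx lt :
  filterlim (fun s => fst (gam s)) G (locally lx) ->
  filterlim (fun s => snd (gam s)) G (locally lt) ->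
  filterlim gam G (locally (lx, lt)).
Proof.
  intros Lx Lt; apply filterlim_locally; intros eps.
  assert (Hx := proj1 (filterlim_locally (fun s => fst (gam s)) lx) Lx eps).
  assert (Ht := proj1 (filterlim_locally (fun s => snd (gam s)) lt) Lt eps).
  generalize (filter_and _ _ Hx Ht); apply filter_imp; intros s [H1 H2]; split; trivial.
Qed.

(** A finite point where the parameter interval stops must be [hi], or [lo] after reversal; limits
    of both coordinates there would be an endpoint excluded by inextendibility. *)
Lemma complete_flow_of_geodesic (b : R) (lo hi : Rbar) (gam : R -> R * R) (hb : b < 0) :
  timelike_geodesic b lo hi gam -> inextendible lo hi gam ->
  complete_axis_flow (- b) (in_interval lo hi) (fun s => fst (gam s)) (fun s => snd (gam s))
    (fun s => fst (gam s) ^ 2 * fst (velocity gam s))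
    (fun s => fst (gam s) ^ 2 *
       (fst (gam s) * snd (velocity gam s) - snd (gam s) * fst (velocity gam s))).
Proof.
  intros TG [Hlo Hhi]; constructor.
  - apply axis_flow_of_geodesic; trivial.
  - intros h s0 lx lt Hs HI Hh Lx Lt.
    destruct (HI s0) as [Hl0 Hh0]; [lra|].
    assert (Hlh : Rbar_lt lo h) by (apply Rbar_lt_trans with s0; trivial).
    assert (E : hi = Finite h).
    { destruct hi as [h'| |]; simpl in Hh0; try contradiction.
      - f_equal; apply Rle_antisym; apply Rnot_lt_le; intros Hlt.
        + apply Hh; split; trivial.
        + destruct (HI (Rmax s0 h')) as [_ H].
          * split; [apply Rmax_l|apply Rmax_lub_lt; trivial].
          * simpl in H; generalize (Rmax_r s0 h'); lra.
      - exfalso; apply Hh; split; simpl; trivial. }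
    subst hi; apply Hhi; exists (lx, lt).
    apply (filterlim_pair_components gam (at_left h) _); trivial.
  - intros h s0 lx lt Hs HI Hh Lx Lt.
    destruct (HI s0) as [Hl0 Hh0]; [lra|].
    assert (Hlh : Rbar_lt (- h) hi) by (apply Rbar_lt_trans with (- s0); trivial; simpl; lra).
    assert (E : lo = Finite (- h)).
    { destruct lo as [l| |]; simpl in Hl0; try contradiction.
      - f_equal; apply Rle_antisym; apply Rnot_lt_le; intros Hlt.
        + destruct (HI (Rmax s0 (- l))) as [H _].
          * split; [apply Rmax_l|apply Rmax_lub_lt; lra].
          * simpl in H; generalize (Rmax_r s0 (- l)); lra.
        + apply Hh; split; trivial.
      - exfalso; apply Hh; split; simpl; trivial. }
    subst lo; apply Hlo; exists (lx, lt).
    assert (Lopp : filterlim Ropp (at_right (- h)) (at_left h)).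
    { rewrite <- (Ropp_involutive h) at 2; apply filterlim_Ropp_right. }
    apply (filterlim_pair_components gam (at_right (- h)) _).
    + apply filterlim_ext with (fun s => fst (gam (- - s))).
      { intros; rewrite Ropp_involutive; trivial. }
      exact (filterlim_comp _ _ _ Ropp (fun s => fst (gam (- s))) _ _ _ Lopp Lx).
    + apply filterlim_ext with (fun s => snd (gam (- - s))).
      { intros; rewrite Ropp_involutive; trivial. }
      exact (filterlim_comp _ _ _ Ropp (fun s => snd (gam (- s))) _ _ _ Lopp Lt).
Qed.

Theorem mainTheorem6 (b : R) (hb : b < 0) :
  exists V : R * R -> R * R,
    time_orientation b V /\
    forall (lo hi : Rbar) (gam : R -> R * R),
      timelike_geodesic b lo hi gam ->
      inextendible lo hi gam ->
      (future_directed b V lo hi gam /\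
         emerges_and_ends lo hi gam (P_minus b) (P_plus b)) \/
      (past_directed b V lo hi gam /\
         emerges_and_ends lo hi gam (P_plus b) (P_minus b)).
Proof.
  (* The field [x d/dt] has square norm [b x^4], negative off the axis. *)
  exists (fun p => (0, fst p)); split.
  { intros [x t] Hx; split.
    - apply (continuous_comp_2 (fun _ : R * R => 0) (fun p : R * R => fst p) (fun u v => (u, v))).
      + apply continuous_const.
      + apply continuous_fst.
      + apply (continuous_ext (fun z : R * R => z)); [intros []; trivial|apply continuous_id].
    - simpl in Hx; unfold gprod, csum, metric; simpl.
      assert (0 < (x ^ 2) ^ 2) by (apply pow2_gt_0, pow_nonzero; trivial); nra. }
  intros lo hi gam TG Hinext.
  destruct (complete_flow_arcs (- b) _ _ _ _ _ ltac:(lra)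
    (complete_flow_of_geodesic b lo hi gam hb TG Hinext)) as (mu & theta & Hmu & Harc & Hcover).
  set (m := fun s => fst (gam s) ^ 2 *
    (fst (gam s) * snd (velocity gam s) - snd (gam s) * fst (velocity gam s))) in Harc.
  assert (Horient : forall s,
    gprod b (gam s) (0, fst (gam s)) (velocity gam s) = b * m s).
  { intros s; unfold gprod, csum, metric, m; simpl; ring. }
  assert (Hm : forall s, in_interval lo hi s -> fst (gam s) <> 0 -> 0 < mu * m s).
  { intros s Hs Hx; destruct (Hcover s Hs) as [k [Hk1 Hk2]]; destruct (Harc k).
    apply arc_interior0; split; trivial.
    destruct Hk1 as [|E]; trivial; subst s; contradiction. }
  (* Keeping [mu] symbolic treats both time directions at once: a positive arc runs from
     [t = - mu / sqrt (- b)] to [t = mu / sqrt (- b)]. *)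
  assert (Hends : forall P Q, P = (0, - (mu / sqrt (- b))) -> Q = (0, mu / sqrt (- b)) ->
    emerges_and_ends lo hi gam P Q).
  { intros P Q -> ->; exists theta.
    assert (Heven : forall k, parity_sign (2 * k) = 1).
    { intros k; unfold parity_sign; rewrite Z.even_mul; trivial. }
    assert (Hodd : forall k, parity_sign (2 * k + 1) = -1).
    { intros k; rewrite parity_sign_succ, Heven; ring. }
    assert (Hpos : forall k s, theta (2 * k)%Z < s < theta (2 * k + 1)%Z -> 0 < fst (gam s)).
    { intros k s Hs; destruct (Harc (2 * k)%Z); destruct (arc_interior0 s Hs) as [H _].
      rewrite Heven in H; lra. }
    assert (Hneg : forall k s, theta (2 * k + 1)%Z < s < theta (2 * k + 2)%Z -> fst (gam s) < 0).
    { intros k s Hs; replace (2 * k + 2)%Z with (2 * k + 1 + 1)%Z in Hs by ring.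
      destruct (Harc (2 * k + 1)%Z); destruct (arc_interior0 s Hs) as [H _].
      rewrite Hodd in H; lra. }
    split; [|split; [|split; [|split; [|split]]]]; trivial.
    - intros k; apply (Harc k).
    - intros s; split.
      + intros [Hs Hx]; destruct (Hcover s Hs) as [k [Hk1 Hk2]]; exists k.
        destruct Hk1 as [Hk1|]; auto; exfalso; destruct (Harc k).
        destruct (arc_interior0 s (conj Hk1 Hk2)) as [H _]; rewrite Hx in H; lra.
      + intros [k ->]; destruct (Harc k); auto.
    - intros k; destruct (Harc (2 * k)%Z); rewrite Heven in *.
      rewrite (surjective_pairing (gam _)), arc_x_l0, arc_t_l0; f_equal; unfold Rdiv; ring.
    - intros k; destruct (Harc (2 * k)%Z); rewrite Heven in *.
      rewrite (surjective_pairing (gam _)), arc_x_r0, arc_t_r0; f_equal; unfold Rdiv; ring. }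
  destruct Hmu as [->| ->]; [left|right]; split.
  - intros s Hs Hx; rewrite Horient; specialize (Hm s Hs Hx); nra.
  - apply Hends; trivial.
  - intros s Hs Hx; rewrite Horient; specialize (Hm s Hs Hx); nra.
  - apply Hends; unfold P_plus, P_minus; f_equal; unfold Rdiv; ring.
Qed.
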